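(* For any rational function $g$ and any non-constant rational function $h$, there exists $\epsilon_0>0$ such that for every $\epsilon\in(0,\epsilon_0)$ there exists a positive integer $N$ such that for every integer $n\geq N$ the following hold: 1. If $z$ is a non-trivial critical point of $h$ with multiplicity $m$, then there are exactly $m$ non-trivial critical points of $g\cdot h^n$ lying within $\epsilon$ of $z$, counted with multiplicity. 2. If $z$ is a (finite) zero or pole of $g$, then there is exactly $1$ non-trivial critical point of $g\cdot h^n$ lying within $\epsilon$ of $z$, counted with multiplicity.
   Context: Rational functions are elements of $\mathbb{C}(z)$, not identically zero; $h^n$ denotes the $n$-th power of $h$. A critical point of a non-constant rational function $f$ is a point of $\mathbb{C}$ that is a zero of $f'$; its multiplicity is its order as a zero of $f'$. A critical point of $f$ is called non-trivial if it is not also a zero or pole of $f$. ''Within $\epsilon$ of $z$'' means at distance less than $\epsilon$ from $z$.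
   Formalization: Item 1 is stated only for z that is neither a zero nor a pole of g, and item 2 only for z that is neither a zero, a pole nor a critical point of h; at the excluded points the true count is m+1 or 0, so the literal claim fails (e.g. g = h = z at 0). *)

(* Defs.v *)
(* R[i], for R : realType, is the field of complex numbers. *)
From HB Require Import structures.
From mathcomp Require Import all_boot all_order all_algebra.
From mathcomp Require Import generic_quotient.
From mathcomp Require Import complex.
From mathcomp Require Import reals.
From mathcomp Require Import ring.

Set Implicit Arguments.
Unset Strict Implicit.
Unset Printing Implicit Defensive.

Import Order.TTheory GRing.Theory Num.Theory.
Local Open Scope ring_scope.

Notation "x %:F" := (@FracField.tofrac _ x) : ring_scope.

Section RationalFunctions.
Variable F : fieldType.
Implicit Types (f : {fraction {poly F}}) (p q : {poly F}) (z : F).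

(* The representative of f is a possibly non-reduced quotient of polynomials;
   ratfun_derivE and ratfun_ordE show that its choice does not matter. *)
Definition ratfun_num f : {poly F} := \n_(repr f).
Definition ratfun_den f : {poly F} := \d_(repr f).

Definition ratfun_deriv f : {fraction {poly F}} :=
  ((ratfun_num f)^`() * ratfun_den f - ratfun_num f * (ratfun_den f)^`())%:F
  / (ratfun_den f ^+ 2)%:F.

(* Negative at poles; meaningful only for f != 0. *)
Definition ratfun_ord f z : int :=
  (mup z (ratfun_num f))%:Z - (mup z (ratfun_den f))%:Z.

Definition ratfun_zero f z : bool := (f != 0) && (0 < ratfun_ord f z).
Definition ratfun_pole f z : bool := (f != 0) && (ratfun_ord f z < 0).

Definition ratfun_nonconstant f : Prop := forall c : F, f <> (c%:P)%:F.

(* In characteristic 0 the derivative of a non-constant f is nonzero, so its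
   order below is meaningful. *)
Definition critical_point f z : Prop :=
  ratfun_nonconstant f /\ ratfun_zero (ratfun_deriv f) z.

Definition critical_multiplicity f z : int := ratfun_ord (ratfun_deriv f) z.

Definition nontrivial_critical_point f z : Prop :=
  [/\ critical_point f z, ~~ ratfun_zero f z & ~~ ratfun_pole f z].

Lemma ratfun_den_neq0 f : ratfun_den f != 0.
Proof. exact: denom_ratioP. Qed.

Lemma ratfun_cross p q : q != 0 ->
  ratfun_num (p%:F / q%:F) * q = p * ratfun_den (p%:F / q%:F).
Proof.
move=> q0.
have [x xE] : exists x : {ratio {poly F}}, repr (p%:F / q%:F) = x
  by exists (repr (p%:F / q%:F)).
rewrite /ratfun_num /ratfun_den xE.
have fE : p%:F / q%:F = \pi_({fraction {poly F}})%qT x by rewrite -xE reprK.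
have pE : p%:F = q%:F * \pi_({fraction {poly F}})%qT x.
  by rewrite -fE mulrC divfK // tofrac_eq0.
have tofE r : r%:F = \pi_({fraction {poly F}})%qT (Ratio r 1).
  by rewrite /FracField.tofrac; unlock.
move: pE; rewrite !tofE -[RHS]FracField.pi_mul => /eqP.
rewrite FracField.equivf_def /FracField.mulf.
have dx0 := denom_ratioP x.
rewrite !numer_Ratio ?denom_Ratio ?oner_neq0 ?mulf_neq0 ?oner_neq0 //.
by rewrite !mul1r => /eqP ->; rewrite mulrC.
Qed.

Lemma ratfun_derivE p q : q != 0 ->
  ratfun_deriv (p%:F / q%:F) = (p^`() * q - p * q^`())%:F / (q ^+ 2)%:F.
Proof.
move=> q0; have := ratfun_cross p q0; rewrite /ratfun_deriv.
move: (ratfun_den_neq0 (p%:F / q%:F)).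
move: (ratfun_num _) (ratfun_den _) => a b b0 e.
have e' := congr1 (fun r : {poly F} => r^`()) e; rewrite /= !derivM in e'.
apply/eqP; rewrite eqr_div ?tofrac_eq0 ?expf_neq0 // -!tofracM tofrac_eq.
apply/eqP; rewrite !mulrBl.
have h1 : a^`() * q = p^`() * b + p * b^`() - a * q^`().
  by rewrite -e' addrK.
have -> : a^`() * b * q ^+ 2 = (a^`() * q) * b * q by rewrite expr2; ring.
rewrite h1.
have -> : a * b^`() * q ^+ 2 = (a * q) * b^`() * q by ring.
rewrite e.
have -> : (p^`() * b + p * b^`() - a * q^`()) * b * q
   = p^`() * b * b * q + p * b^`() * b * q - (a * q) * q^`() * b by ring.
by rewrite e; ring.
Qed.

Lemma ratfun_ordE p q z : p != 0 -> q != 0 ->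
  ratfun_ord (p%:F / q%:F) z = (mup z p)%:Z - (mup z q)%:Z.
Proof.
move=> p0 q0; have := ratfun_cross p q0; rewrite /ratfun_ord.
move: (ratfun_den_neq0 (p%:F / q%:F)).
move: (ratfun_num _) (ratfun_den _) => a b b0 e.
have a0 : a != 0.
  by apply: contraTneq (mulf_neq0 p0 b0) => a0; rewrite -e a0 mul0r eqxx.
have /(congr1 Posz) := congr1 (mup z) e.
rewrite !mupM // !PoszD => e'; apply/eqP.
by rewrite subr_eq addrAC eq_sym subr_eq e'.
Qed.

End RationalFunctions.

(* s lists the non-trivial critical points of f in the open disc, which are
   therefore finitely many. *)
Definition exactly_critical_within (R : realType) (f : {fraction {poly R[i]}})
    (z : R[i]) (eps : R) (m : int) : Prop :=
  exists s : seq R[i],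
    [/\ uniq s,
        forall w : R[i], w \in s <->
          nontrivial_critical_point f w /\ `|w - z| < (eps%:C)%C
      & \sum_(w <- s) critical_multiplicity f w = m].

(* Main.v *)
(* Write g = a / b and h = p / q in lowest terms. Away from the zeros and poles of
   g and h, the critical points of g h^n are the roots of A + n B, where
   A = (a' b - a b') p q and B = (p' q - p q') a b, with the same multiplicities.
   For n large, A + n B has as many roots near z as B does. At a non-trivial
   critical point of h this number is the multiplicity m. At a zero or pole z of g
   of order k, B vanishes to order k, but A, hence A + n B, only to order k - 1,
   so exactly one of the k nearby roots differs from z. *)
Require Import Defs.
From HB Require Import structures.
From mathcomp Require Import all_boot all_order all_algebra.
From mathcomp Require Import generic_quotient.
From mathcomp Require Import complex.
From mathcomp Require Import reals.
From mathcomp Require Import ring.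

Import Order.TTheory GRing.Theory Num.Theory.
Local Open Scope ring_scope.

Set Implicit Arguments.
Unset Strict Implicit.
Unset Printing Implicit Defensive.

(** * Counting the roots of a polynomial near a point through a dominant coefficient *)

Section DominantTerm.
Variable C : numFieldType.
Implicit Types (p q : {poly C}) (c u z d eta rho : C).

Definition norm1 p : C := \sum_(i < size p) `|p`_i|.

Lemma norm1_widen n p : (size p <= n)%N -> norm1 p = \sum_(i < n) `|p`_i|.
Proof.
move=> le_n; rewrite /norm1 (big_ord_widen n (fun i => `|p`_i|) le_n).
rewrite big_mkcond; apply: eq_bigr => i _; case: ltnP => // le_i.
by rewrite nth_default // normr0.
Qed.

Lemma norm1_ge0 p : 0 <= norm1 p.
Proof. by apply: sumr_ge0 => i _; exact: normr_ge0. Qed.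

Lemma norm1D p q : norm1 (p + q) <= norm1 p + norm1 q.
Proof.
pose n := maxn (size p) (size q).
rewrite (@norm1_widen n) ?size_polyD // (@norm1_widen n p) ?leq_maxl //.
rewrite (@norm1_widen n q) ?leq_maxr // -big_split /=.
by apply: ler_sum => i _; rewrite coefD ler_normD.
Qed.

Lemma norm1Z c p : norm1 (c *: p) = `|c| * norm1 p.
Proof.
rewrite (norm1_widen (size_scale_leq c p)) /norm1 mulr_sumr.
by apply: eq_bigr => i _; rewrite coefZ normrM.
Qed.

Lemma norm1N p : norm1 (- p) = norm1 p.
Proof. by rewrite -scaleN1r norm1Z normrN1 mul1r. Qed.

Lemma norm1B p q : norm1 (p - q) <= norm1 p + norm1 q.
Proof. by rewrite -(norm1N q) norm1D. Qed.

Lemma norm1MXn p n : norm1 (p * 'X^n) = norm1 p.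
Proof.
rewrite (@norm1_widen (n + size p)); last first.
  by rewrite (leq_trans (size_polyMleq _ _)) // size_polyXn addnS addnC.
rewrite big_split_ord /= big1 => [|i _]; last first.
  by rewrite coefMXn ltn_ord normr0.
rewrite add0r; apply: eq_bigr => i _.
by rewrite coefMXn ltnNge leq_addr /= addKn.
Qed.

Lemma norm1Xn n : norm1 'X^n = 1.
Proof.
by rewrite -['X^n]mul1r norm1MXn /norm1 size_poly1 big_ord1 coef1 normr1.
Qed.

Lemma norm1C c : norm1 c%:P = `|c|.
Proof. by rewrite -[c%:P]mulr1 mul_polyC norm1Z -(expr0 'X) norm1Xn mulr1. Qed.

Lemma norm1MZX q u c : norm1 (q * (u *: 'X)) = `|u| * norm1 q.
Proof. by rewrite -scalerAr norm1Z -['X]expr1 norm1MXn. Qed.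

Lemma ler_norm1_horner p u (n : nat) b : (size p <= n)%N ->
  (forall i, (i < n)%N -> `|u| ^+ i <= b) -> `|p.[u]| <= norm1 p * b.
Proof.
move=> le_n le_b; rewrite horner_coef; apply: le_trans (ler_norm_sum _ _ _) _.
rewrite /norm1 mulr_suml; apply: ler_sum => i _.
by rewrite normrM normrX ler_wpM2l // le_b // (leq_trans (ltn_ord i)).
Qed.

(** Each Horner step multiplies by [rho *: 'X + z%:P], whose norm is at most [1 + |z|] once
    [rho <= 1]. A single bound thus serves all small radii. *)
Lemma norm1_comp_bound p z :
  exists2 K : C, 0 <= K & forall rho, 0 <= rho -> rho <= 1 ->
    norm1 (p \Po (rho *: 'X + z%:P)) <= K.
Proof.
elim/poly_ind: p => [|p c [K K0 IH]].
  exists 0 => // rho _ _; rewrite comp_poly0 -(polyC0 C) norm1C normr0 //.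
exists (K * (1 + `|z|) + `|c|) => [|rho rho0 rho1].
  by rewrite addr_ge0 ?mulr_ge0 ?addr_ge0.
rewrite comp_poly_MXaddC; apply: le_trans (norm1D _ _) _.
rewrite norm1C lerD2r mulrDr -[_ * z%:P]mulrC mul_polyC.
apply: le_trans (norm1D _ _) _; rewrite norm1MZX // norm1Z mulrDr mulr1.
have KP := IH _ rho0 rho1.
apply: lerD; last by rewrite mulrC ler_wpM2r.
by rewrite ger0_norm // -[leRHS]mul1r ler_pM ?norm1_ge0.
Qed.

(** For [d < 1] this is a coefficient version of the hypothesis of Rouché's theorem, comparing [p]
    with one monomial on the unit circle. *)
Definition dominant k d p : Prop :=
  exists2 c : C, c != 0 & norm1 (p - c *: 'X^k) <= d * `|c|.

(** If the degrees differed, the difference of the two remainders would consist of two separate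
    monomials, of norm [|c| + |c'|]. The remainders together have strictly smaller norm. *)
Lemma dominant_uniq k m d d' p : d < 1 -> d' < 1 ->
  dominant k d p -> dominant m d' p -> k = m.
Proof.
move=> d1 d'1 [c c0 hc] [c' c'0 hc']; apply/eqP; apply: contraT => neq_km.
have := norm1B (p - c *: 'X^k) (p - c' *: 'X^m).
have -> : p - c *: 'X^k - (p - c' *: 'X^m) = c' *: 'X^m - c *: 'X^k by ring.
have -> : norm1 (c' *: 'X^m - c *: 'X^k) = `|c| + `|c'|.
  pose n := maxn k m; have [kn mn] : (k < n.+1)%N /\ (m < n.+1)%N.
    by rewrite !ltnS leq_maxl leq_maxr.
  rewrite (@norm1_widen n.+1); last first.
    rewrite (leq_trans (size_polyD _ _)) // geq_max size_polyN.
    by rewrite !(leq_trans (size_scale_leq _ _)) // size_polyXn.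
  rewrite (bigD1 (Ordinal kn)) //= (bigD1 (Ordinal mn)) /=; last first.
    by rewrite -val_eqE /= eq_sym.
  rewrite big1 ?addr0.
    rewrite !(coefB, coefZ, coefXn) !eqxx (negPf neq_km) eq_sym (negPf neq_km).
    by rewrite !mulr0 !mulr1 subr0 sub0r normrN.
  move=> i /andP[ik im]; rewrite !(coefB, coefZ, coefXn).
  rewrite -!val_eqE /= in ik im.
  by rewrite (negPf ik) (negPf im) !mulr0 subr0 normr0.
move=> le1; suff : `|c| + `|c'| < `|c| + `|c'| by rewrite ltxx.
apply: le_lt_trans (le_trans le1 (lerD hc hc')) _.
by rewrite ltrD // gtr_pMl // normr_gt0.
Qed.

Lemma dominantZ k d a p : a != 0 -> dominant k d p -> dominant k d (a *: p).
Proof.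
move=> a0 [c c0 hc]; exists (a * c); first by rewrite mulf_neq0.
by rewrite -scalerA -scalerBr norm1Z normrM mulrCA ler_wpM2l.
Qed.

(** A root near 0 acts like the factor ['X]: the dominant degree rises by one, and the relative
    errors compound as [(1 + d) * (1 + eta)]. *)
Lemma dominantM_small k d eta u p : `|u| <= eta -> dominant k d p ->
  dominant k.+1 ((1 + d) * (1 + eta) - 1) (p * ('X - u%:P)).
Proof.
move=> ueta [c c0 hc]; exists c => //; set E : {poly C} := p - _ in hc.
have -> : p * ('X - u%:P) - c *: 'X^(k.+1) =
   E * 'X^1 - (u *: E + (u * c) *: 'X^k).
  by rewrite /E -!mul_polyC polyCM (exprS _ k); ring.
apply: le_trans (norm1B _ _) _; rewrite norm1MXn.
apply: le_trans (lerD (lexx _) (norm1D _ _)) _; rewrite !norm1Z norm1Xn mulr1.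
have -> : ((1 + d) * (1 + eta) - 1) * `|c| =
  d * `|c| + (eta * (d * `|c|) + eta * `|c|) by ring.
by rewrite !lerD // ?normrM ?ler_wpM2r // ler_pM ?norm1_ge0.
Qed.

(** A distant root acts like a constant factor: ['X - u%:P] is [- u] times [1 - u^-1 *: 'X], and
    [dominantZ] absorbs the scalar. *)
Lemma dominantM_large k d eta u p : u != 0 -> `|u^-1| <= eta ->
  dominant k d p ->
  dominant k ((1 + d) * (1 + eta) - 1) (p * ('X - u%:P)).
Proof.
move=> u0 ueta [c c0 hc].
have -> : p * ('X - u%:P) = (- u) *: (p * (1 - u^-1 *: 'X)).
  rewrite scalerAr scalerBr scalerA mulNr divff // scaleN1r opprK scaleNr.
  by rewrite -mul_polyC mulr1 [in RHS]addrC.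
apply: dominantZ; first by rewrite oppr_eq0.
exists c => //; set E : {poly C} := p - _ in hc.
have -> : p * (1 - u^-1 *: 'X) - c *: 'X^k =
   E - (u^-1 *: (E * 'X^1) + (u^-1 * c) *: 'X^(k.+1)).
  move: u^-1 => v.
  by rewrite /E -!mul_polyC polyCM (exprS _ k); ring.
apply: le_trans (norm1B _ _) _.
apply: le_trans (lerD (lexx _) (norm1D _ _)) _.
rewrite !norm1Z norm1MXn norm1Xn mulr1.
have -> : ((1 + d) * (1 + eta) - 1) * `|c| =
  d * `|c| + (eta * (d * `|c|) + eta * `|c|) by ring.
by rewrite !lerD // ?normrM ?ler_wpM2r // ler_pM ?norm1_ge0.
Qed.

(** Each linear factor multiplies [1 + d] by [1 + eta], and only the small roots raise the degree.
    Since [eta < 1], the test [|u| < 1] tells the two kinds apart. *)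
Lemma dominant_prod_XsubC eta (rs : seq C) : eta < 1 ->
    {in rs, forall u, `|u| <= eta \/ u != 0 /\ `|u^-1| <= eta} ->
  dominant (count (fun u => `|u| < 1) rs) ((1 + eta) ^+ size rs - 1)
    (\prod_(u <- rs) ('X - u%:P)).
Proof.
move=> eta1; elim: rs => [|u rs IH] H.
  by rewrite big_nil /=; exists 1; rewrite ?oner_neq0 //
    expr0 scale1r !subrr mul0r -(polyC0 C) norm1C normr0.
rewrite big_cons mulrC /=.
have {}IH := IH (fun v vrs => H v (mem_behead (s := u :: rs) vrs)).
have -> : (1 + eta) ^+ (size rs).+1 - 1 =
  (1 + ((1 + eta) ^+ size rs - 1)) * (1 + eta) - 1 by rewrite exprSr; ring.
case: (H u (mem_head _ _)) => [le_u|[u0 le_u]].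
  by rewrite (le_lt_trans le_u eta1); apply: dominantM_small.
suff -> : (`|u| < 1) = false by apply: dominantM_large.
have u_gt0 : 0 < `|u| by rewrite normr_gt0.
apply: le_gtF; rewrite -invf_le1 // -normfV; exact: le_trans (ltW eta1).
Qed.

(** At a root the remainder cancels the monomial [c u^m], so [|u|^m] is at most [eta^(n+1)] times
    the larger of 1 and [|u|^n]. In the unit disc this makes [|u|^m] small, outside it makes
    [|u^-1|^(n-m)] small. *)
Lemma dominant_root_separation n m eta u p :
    0 < eta -> eta < 1 -> (size p <= n.+1)%N -> (m <= n)%N ->
    dominant m (eta ^+ n.+1) p -> root p u ->
  `|u| <= eta \/ u != 0 /\ `|u^-1| <= eta.
Proof.
move=> eta0 eta1 szp le_mn [c c0 hc] /rootP pu.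
set E : {poly C} := p - _ in hc.
have szE : (size E <= n.+1)%N.
  rewrite (leq_trans (size_polyD _ _)) // geq_max szp size_polyN.
  by rewrite (leq_trans (size_scale_leq _ _)) // size_polyXn.
have Eu : E.[u] = - (c * u ^+ m) by rewrite /E !hornerE pu sub0r.
have c_gt0 : 0 < `|c| by rewrite normr_gt0.
have key b : (forall i, (i < n.+1)%N -> `|u| ^+ i <= b) ->
    `|u| ^+ m <= eta ^+ n.+1 * b.
  move=> hb; rewrite -(ler_pM2l c_gt0).
  have := ler_norm1_horner szE hb; rewrite Eu normrN normrM normrX.
  move=> /le_trans; apply.
  have b0 : 0 <= b by apply: le_trans (hb 0 isT); rewrite expr0 ler01.
  by rewrite mulrCA mulrA ler_wpM2r.
(* The exponent [n.+1] exceeds every [k] that occurs, so [v > eta] would give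
   [v ^+ k >= eta ^+ k > eta ^+ n.+1]. This includes [k = 0], where the assumption on [v] is already
   contradictory. *)
have eta_small k v : (k <= n)%N -> 0 <= v -> v ^+ k <= eta ^+ n.+1 -> v <= eta.
  move=> le_kn v0 hv; case: (real_leP (ger0_real v0) (gtr0_real eta0)) => // lt_v.
  suff : eta ^+ n.+1 < eta ^+ n.+1 by rewrite ltxx.
  apply: lt_le_trans hv; apply: (@lt_le_trans _ _ (eta ^+ k)).
    by rewrite ltr_iXn2l // ltnS.
  by rewrite lerXn2r ?nnegrE // ltW.
case: (real_leP (normr_real u) (real1 C)) => [u1|u1].
  left; apply: (eta_small m) => //.
  by rewrite -[leRHS]mulr1; apply: key => i _; rewrite exprn_ile1.
have u0 : u != 0 by rewrite -normr_gt0 (lt_trans ltr01).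
right; split=> //; apply: (eta_small (n - m)%N) => //; first exact: leq_subr.
have un0 : 0 < `|u| by rewrite normr_gt0.
have hk : `|u| ^+ m <= eta ^+ n.+1 * `|u| ^+ n.
  by apply: key => i; rewrite ltnS => le_in; rewrite ler_eXn2l.
rewrite normfV exprVn -(ler_pM2r (exprn_gt0 n un0)) (le_trans _ hk) //.
by rewrite -{2}(subnK le_mn) exprD mulKf // expf_neq0 // gt_eqF.
Qed.

(** The right-hand side is the chord over [0, 1] of a convex function of [eta]. *)
Lemma expr1D_le eta n : 0 <= eta -> eta <= 1 ->
  (1 + eta) ^+ n <= 1 + (2 ^+ n - 1) * eta.
Proof.
move=> eta0 eta1; elim: n => [|n IH]; first by rewrite !expr0 subrr mul0r addr0.
have e1 : 0 <= 1 + eta by rewrite addr_ge0.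
rewrite exprSr (le_trans (ler_wpM2r e1 IH)) //.
rewrite -subr_ge0.
have -> : 1 + (2 ^+ n.+1 - 1) * eta - (1 + (2 ^+ n - 1) * eta) * (1 + eta) =
  (2 ^+ n - 1) * eta * (1 - eta) by rewrite exprS; ring.
by rewrite !mulr_ge0 ?subr_ge0 // exprn_ege1 // ler1n.
Qed.

(* Dominance at z on scale rho separates the roots of p: all of them are either
   much closer to z than rho or much farther. Multiplying out the linear factors
   then produces a dominant term whose degree is the number of close roots. *)
Lemma count_roots_dominant n m c z rho (rs : seq C) p :
    0 < rho -> c != 0 -> p = c *: \prod_(r <- rs) ('X - r%:P) ->
    (size p <= n.+1)%N -> (m <= n)%N ->
    dominant m ((2 ^- n.+1) ^+ n.+1) (p \Po (rho *: 'X + z%:P)) ->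
  count (fun r => `|r - z| < rho) rs = m.
Proof.
move=> rho0 c0 pE szp le_mn domp; set eta : C := 2 ^- n.+1 in domp.
have rhoN0 : rho != 0 by rewrite gt_eqF.
have eta0 : 0 < eta by rewrite invr_gt0 exprn_gt0 // ltr0n.
have eta1 : eta < 1 by rewrite invf_lt1 ?exprn_gt0 ?ltr0n // exprn_egt1 // ltr1n.
(* The roots in the coordinate that carries the disc of radius [rho] about [z] to the unit disc. *)
pose us := [seq (r - z) / rho | r <- rs].
have pTE : p \Po (rho *: 'X + z%:P) =
    (c * rho ^+ size rs) *: \prod_(u <- us) ('X - u%:P).
  rewrite pE comp_polyZ rmorph_prod -scalerA; congr (_ *: _).
  rewrite /us big_map; elim: (rs) => [|r s IH].
    by rewrite !big_nil expr0 scale1r.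
  rewrite !big_cons IH exprSr -scalerA -scalerAr scalerAl.
  rewrite -!scalerAl; congr (_ *: _); rewrite scalerAl; congr (_ * _).
  rewrite rmorphB /= comp_polyX comp_polyC.
  rewrite scalerBr -[_ *: _%:P]mul_polyC -polyCM [rho * _]mulrC divfK //.
  by rewrite polyCB; ring.
have a0 : c * rho ^+ size rs != 0 by rewrite mulf_neq0 ?expf_neq0.
have sz_rs : (size rs <= n)%N.
  by move: szp; rewrite pE size_scale // size_prod_XsubC.
have sep : {in us, forall u, `|u| <= eta \/ u != 0 /\ `|u^-1| <= eta}.
  move=> u uus; apply: (dominant_root_separation eta0 eta1 _ le_mn domp).
    by rewrite pTE size_scale // size_prod_XsubC size_map ltnS.
  by rewrite pTE rootZ // root_prod_XsubC.
(* The same polynomial is now dominant in two degrees, the number of close roots and [m]; these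
   agree by uniqueness. *)
have := dominantZ a0 (dominant_prod_XsubC eta1 sep); rewrite -pTE => domk.
rewrite -(dominant_uniq _ _ domk domp).
- rewrite /us count_map; apply: eq_count => r /=.
  by rewrite normrM normfV (gtr0_norm rho0) ltr_pdivrMr // mul1r.
(* The accumulated error is at most [(2 ^+ n - 1) * eta], which is below 1 because [eta] is
   [2 ^- n.+1]. *)
- rewrite ltrBlDr (le_lt_trans (expr1D_le _ (ltW eta0) (ltW eta1))) //.
  rewrite ltrD2l size_map (@le_lt_trans _ _ ((2 ^+ n - 1) * eta)) //.
    by apply: ler_wpM2r; rewrite ?lerD2r ?ler_weXn2l ?ler1n // ltW.
  rewrite ltr_pdivrMr ?exprn_gt0 ?ltr0n // mul1r exprS ltrBlDr.
  have t0 : 0 < (2 : C) ^+ n by rewrite exprn_gt0 // ltr0n.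
  by rewrite mulr_natl mulr2n -addrA ltrDl addr_gt0.
- by rewrite exprn_ilt1 // ltW.
Qed.

(* The dominant term of (A + kB)(z + eps X) is k b eps^m X^m, where b (X - z)^m
   is the leading part of B at z: for small eps it beats the rest of kB, and for
   large k it beats A. *)
Lemma count_roots_pencil (A B : {poly C}) z m (B1 : {poly C}) :
    B = ('X - z%:P) ^+ m * B1 -> ~~ root B1 z ->
  exists2 eps0 : C, 0 < eps0 & forall eps, 0 < eps -> eps < eps0 ->
  exists2 K : C, 0 <= K & forall k : nat, K <= k%:R ->
  A + k%:R *: B != 0 /\
  forall c (rs : seq C), A + k%:R *: B = c *: \prod_(r <- rs) ('X - r%:P) ->
    count (fun r => `|r - z| < eps) rs = m.
Proof.
move=> BE B1z; set b := B1.[z]; have b0 : b != 0 by rewrite -rootE.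
(* The value [b] feeds the dominant coefficient; the part with [B2] gains an extra factor [eps]
   after rescaling. *)
have [B2 B1E] : exists B2, B1 = b%:P + ('X - z%:P) * B2.
  have /factor_theorem[B2 E] : root (B1 - b%:P) z.
    by rewrite rootE !hornerE subrr.
  by exists B2; rewrite mulrC -E addrC subrK.
have [KA KA0 HA] := norm1_comp_bound A z.
have [KB KB0 HB] := norm1_comp_bound B2 z.
pose n := maxn (size A) (size B).
set d : C := (2 ^- n.+1) ^+ n.+1.
have d0 : 0 < d by rewrite exprn_gt0 // invr_gt0 exprn_gt0 // ltr0n.
have d1 : d < 1.
  by rewrite exprn_ilt1 ?invr_ge0 ?exprn_ge0 ?ler0n // invf_lt1
             ?exprn_gt0 ?ltr0n // exprn_egt1 // ltr1n.
pose y := d * `|b|; have y0 : 0 < y by rewrite mulr_gt0 ?normr_gt0.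
have yKB : 0 < 2 * KB + y by rewrite ltr_wpDl // mulr_ge0.
(* This radius gives both [e <= 1], as the bounds [KA] and [KB] require, and [2 * (e * KB) <= y]. *)
exists (y / (2 * KB + y)); first by rewrite divr_gt0.
move=> e e0; rewrite ltr_pdivlMr // => /ltW hy.
have e1 : e <= 1.
  rewrite -(ler_pM2r yKB) (le_trans hy) // mul1r lerDr mulr_ge0 //.
have em0 : 0 < e ^+ m by rewrite exprn_gt0.
have eKB : 2 * (e * KB) <= y.
  apply: le_trans hy; rewrite mulrDr mulrCA lerDl mulr_ge0 ?ltW //.
(* The quotient makes [2 * KA <= k * y * e ^+ m]; the added 1 forces [k] to be positive. *)
exists (2 * KA / (y * e ^+ m) + 1) => [|k hk].
  by rewrite addr_ge0 // divr_ge0 ?mulr_ge0 // ltW.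
have k0 : 0 < k%:R :> C.
  by apply: lt_le_trans hk; rewrite ltr_wpDl // divr_ge0 ?mulr_ge0 // ltW.
have kKA : 2 * KA <= k%:R * (y * e ^+ m).
  have yem0 : 0 < y * e ^+ m by rewrite mulr_gt0.
  by rewrite -(ler_pdivrMr _ _ yem0) (le_trans _ hk) // lerDl.
set P := A + _; set T := fun p : {poly C} => p \Po (e *: 'X + z%:P).
pose c0 := k%:R * b * e ^+ m.
have c0N0 : c0 != 0 by rewrite !mulf_neq0 // gt_eqF.
have le_mn : (m <= n)%N.
  rewrite leq_max; apply/orP; right.
  have B1N0 : B1 != 0 by apply: contraNneq B1z => ->; exact: root0.
  rewrite BE mulrC size_Mmonic ?monic_exp ?monicXsubC // size_exp_XsubC addnS /=.
  exact: leq_addl.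
have szP : (size P <= n.+1)%N.
  rewrite (leq_trans (size_polyD _ _)) // (leq_trans _ (leqnSn n)) //.
  by rewrite geq_max leq_maxl (leq_trans (size_scale_leq _ _)) // leq_maxr.
have domP : dominant m d (T P).
  exists c0 => //.
  have -> : T P - c0 *: 'X^m = T A + (k%:R * e ^+ m * e) *: (T B2 * 'X^(m.+1)).
    rewrite /T /P BE B1E -polyCN comp_polyD comp_polyZ !(comp_polyM, comp_polyD).
    rewrite comp_polyC rmorphXn /= comp_polyD comp_polyX !comp_polyC polyCN addrK.
    rewrite exprZn -!mul_polyC /c0 !polyCM polyC_exp (exprS _ m) -[LHS]addrA.
    by congr (_ + _); ring.
  apply: le_trans (norm1D _ _) _; rewrite norm1Z norm1MXn.
  have ke0 : 0 <= k%:R * e ^+ m * e by rewrite !mulr_ge0 // ltW.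
  rewrite (ger0_norm ke0).
  have -> : d * `|c0| = k%:R * (y * e ^+ m).
    by rewrite /c0 !normrM (gtr0_norm k0) (gtr0_norm em0) /y; ring.
  apply: (@le_trans _ _ (KA + k%:R * e ^+ m * e * KB)).
    by rewrite lerD ?HA ?ler_wpM2l ?HB // ltW.
  (* After doubling, the contributions of [A] and of [B2] are each at most the full allowance
     [k * y * e ^+ m]. *)
  rewrite -(ler_pM2l (ltr0n C 2)).
  have -> : 2 * (k%:R * (y * e ^+ m)) =
      k%:R * (y * e ^+ m) + k%:R * e ^+ m * y by ring.
  rewrite mulrDr lerD //.
  have -> : 2 * (k%:R * e ^+ m * e * KB) = k%:R * e ^+ m * (2 * (e * KB)) by ring.
  by rewrite ler_wpM2l // mulr_ge0 ?ltW.
(* The zero polynomial has no dominant term: that would mean [|c| <= d * |c|] with [d < 1] and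
   [c != 0]. *)
have P0 : P != 0.
  case: domP => c c_neq0 hc; apply: contraTneq hc => ->; rewrite /T comp_poly0 sub0r.
  by rewrite norm1N norm1Z norm1Xn mulr1 lt_geF // gtr_pMl // normr_gt0.
split=> // c rs PE; apply: (count_roots_dominant e0 _ PE szP le_mn domP).
by apply: contraNneq P0 => c_eq0; rewrite PE c_eq0 scale0r.
Qed.

End DominantTerm.

(** * Fractions in lowest terms and the critical points of a product with a power *)

Section ReducedFractions.
Variable F : fieldType.
Implicit Types (f : {fraction {poly F}}) (p q a b : {poly F}) (z : F).

Lemma ratfun_reduced f :
  exists p q, [/\ q != 0, coprimep p q & f = p%:F / q%:F].
Proof.
elim/quotW: f => x; set n := (frac x).1; set d := (frac x).2.
have d0 : d != 0 := denom_ratioP x.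
have tofE (r : {poly F}) : r%:F = \pi_({fraction {poly F}})%qT (Ratio r 1).
  by rewrite /FracField.tofrac; unlock.
have fE : \pi_({fraction {poly F}})%qT x = n%:F / d%:F.
  apply: (canRL (mulfK _)); first by rewrite tofrac_eq0.
  rewrite !tofE -[LHS]FracField.pi_mul; apply/eqP.
  rewrite FracField.equivf_def /FracField.mulf.
  by rewrite !(numer_Ratio, denom_Ratio) ?mulf_neq0 ?oner_neq0 //
             !mulr1 mulrC.
set r := gcdp n d.
have r0 : r != 0 by rewrite gcdp_eq0 negb_and d0 orbT.
have nE : n = n %/ r * r by rewrite divpK ?dvdp_gcdl.
have dE : d = d %/ r * r by rewrite divpK ?dvdp_gcdr.
have d'0 : d %/ r != 0 by apply: contraNneq d0 => d'0; rewrite dE d'0 mul0r.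
exists (n %/ r), (d %/ r); split=> //.
  by rewrite coprimep_div_gcd // d0 orbT.
rewrite fE {1}nE {1}dE !tofracM -mulf_div divff ?mulr1 //.
by rewrite tofrac_eq0.
Qed.

Lemma mup_exact k z p p1 :
  p = ('X - z%:P) ^+ k * p1 -> ~~ root p1 z -> mup z p = k.
Proof. by move=> -> Np1; rewrite mupMl // mup_XsubCX eqxx. Qed.

Lemma mup_decomp z p : p != 0 ->
  exists2 p1, p = ('X - z%:P) ^+ mup z p * p1 & ~~ root p1 z.
Proof.
move=> p0; have := leqnn (mup z p); rewrite mup_geq // => /dvdpP[p1 pE].
exists p1; first by rewrite mulrC.
have p10 : p1 != 0 by apply: contraNneq p0 => p10; rewrite pE p10 mul0r.
rewrite -dvdp_XsubCl XsubC_dvd // -leqNgt.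
have := congr1 (mup z) pE.
rewrite mupM ?expf_neq0 ?polyXsubC_eq0 // mup_XsubCX eqxx => e.
by rewrite leqn0 -(eqn_add2r (mup z p)) -e.
Qed.

Lemma mup_gt0 z p : p != 0 -> (0 < mup z p)%N = root p z.
Proof. by move=> p0; rewrite -XsubC_dvd // dvdp_XsubCl. Qed.

Lemma frac_neq0 p q : q != 0 -> p != 0 -> p%:F / q%:F != 0.
Proof. by move=> q0 p0; rewrite mulf_neq0 ?invr_eq0 ?tofrac_eq0. Qed.

(** In lowest terms at most one of the two multiplicities at [z] is nonzero, so no cancellation
    occurs in the order. *)
Lemma ratfun_zero_reduced p q z : p != 0 -> q != 0 -> coprimep p q ->
  ratfun_zero (p%:F / q%:F) z = root p z.
Proof.
move=> p0 q0 co; rewrite /ratfun_zero frac_neq0 //= ratfun_ordE //.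
have [pz|pz] := boolP (root p z).
  by rewrite (mupNroot (coprimep_root co pz)) subr0 ltz_nat mup_gt0.
by rewrite (mupNroot pz) sub0r oppr_gt0 ltNge.
Qed.

Lemma ratfun_pole_reduced p q z : p != 0 -> q != 0 -> coprimep p q ->
  ratfun_pole (p%:F / q%:F) z = root q z.
Proof.
move=> p0 q0 co; rewrite /ratfun_pole frac_neq0 //= ratfun_ordE //.
have [qz|qz] := boolP (root q z).
  rewrite coprimep_sym in co.
  by rewrite (mupNroot (coprimep_root co qz)) sub0r oppr_lt0 ltz_nat mup_gt0.
by rewrite (mupNroot qz) subr0 ltNge.
Qed.

Lemma ratfun_nonconstant_deriv f : ratfun_deriv f != 0 -> ratfun_nonconstant f.
Proof.
move=> df0 c fE; move: df0; rewrite fE -[_%:F]divr1 -tofrac1.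
by rewrite ratfun_derivE ?oner_neq0 // derivC mul0r derivE mulr0 subrr
           tofrac0 mul0r eqxx.
Qed.

(** Order 0 gives non-triviality, and a nonzero derivative gives non-constancy; only the vanishing
    of the derivative remains. *)
Lemma nontrivial_critical_ord0 f z :
    ratfun_ord f z = 0 -> ratfun_deriv f != 0 ->
  nontrivial_critical_point f z <-> 0 < critical_multiplicity f z.
Proof.
move=> ordf df0.
have zf : ratfun_zero f z = false by rewrite /ratfun_zero ordf ltxx andbF.
have pf : ratfun_pole f z = false by rewrite /ratfun_pole ordf ltxx andbF.
split=> [[[_ /andP[]]] //|mult]; split; rewrite ?zf ?pf //.
by split; [exact: ratfun_nonconstant_deriv | apply/andP].
Qed.

Lemma not_nontrivial_critical_ord f z :
  f != 0 -> ratfun_ord f z != 0 -> ~ nontrivial_critical_point f z.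
Proof.
move=> f0; rewrite neq_lt => /orP[lt0|gt0] [_ /negP zf /negP pf].
  by apply: pf; rewrite /ratfun_pole f0.
by apply: zf; rewrite /ratfun_zero f0.
Qed.

(** Divided by [q ^+ 2] this is the derivative of [p / q]; divided by [p * q], its logarithmic
    derivative. *)
Definition wronskian p q : {poly F} := p^`() * q - p * q^`().

(* The left-hand side is the numerator of the derivative of g h^(n+1) for
   g = a / b and h = p / q, and the second factor on the right is the numerator
   of g' / g + (n+1) h' / h. *)
Lemma wronskian_mul_exp a b p q n :
  wronskian (a * p ^+ n.+1) (b * q ^+ n.+1) =
  (p * q) ^+ n *
    (wronskian a b * (p * q) + n.+1%:R *: (wronskian p q * (a * b))).
Proof.
rewrite /wronskian !derivM !deriv_exp -!(mulr_natl (_ * _)) -mul_polyC polyC_natr /=.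
rewrite exprMn !exprS.
move: (p ^+ n) (q ^+ n) n.+1%:R (a^`()) (b^`()) (p^`()) (q^`()).
by move=> pn qn k da db dp dq; ring.
Qed.

Lemma wronskianC p q : wronskian q p = - wronskian p q.
Proof. by rewrite /wronskian opprB; congr (_ - _); exact: mulrC. Qed.

Section PowerProduct.
Variables (a b p q : {poly F}) (n : nat).
Hypotheses (a0 : a != 0) (b0 : b != 0) (p0 : p != 0) (q0 : q != 0).

(** A successor exponent lets the power [(p * q) ^+ n] split off the derivative without truncated
    subtraction. *)
Let f : {fraction {poly F}} := a%:F / b%:F * (p%:F / q%:F) ^+ n.+1.
Let P := wronskian a b * (p * q) + n.+1%:R *: (wronskian p q * (a * b)).

Let fE : f = (a * p ^+ n.+1)%:F / (b * q ^+ n.+1)%:F.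
Proof. by rewrite /f expr_div_n mulf_div -!tofracXn -!tofracM. Qed.

Let num0 : a * p ^+ n.+1 != 0. Proof. by rewrite mulf_neq0 ?expf_neq0. Qed.
Let den0 : b * q ^+ n.+1 != 0. Proof. by rewrite mulf_neq0 ?expf_neq0. Qed.

Let derivE : ratfun_deriv f = ((p * q) ^+ n * P)%:F / ((b * q ^+ n.+1) ^+ 2)%:F.
Proof. by rewrite fE ratfun_derivE // -/(wronskian _ _) wronskian_mul_exp. Qed.

(** At such a point neither the split-off power of [p * q] nor the denominator vanishes, so [P]
    alone carries the order. *)
Lemma critical_multiplicity_mul_exp z : P != 0 -> ~~ root (a * b * (p * q)) z ->
  critical_multiplicity f z = mup z P.
Proof.
rewrite !rootM !negb_or => P0 /andP[/andP[az bz] /andP[pz qz]].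
rewrite /critical_multiplicity derivE ratfun_ordE ?mulf_neq0 ?expf_neq0 ?mulf_neq0 //.
rewrite mupMr; last first.
  by rewrite rootE horner_exp expf_neq0 // hornerM mulf_neq0.
rewrite [mup z (_ ^+ 2)]mupNroot ?subr0 //.
by rewrite rootE horner_exp expf_neq0 // hornerM horner_exp mulf_neq0 ?expf_neq0.
Qed.

Lemma nontrivial_critical_mul_exp z : P != 0 -> ~~ root (a * b * (p * q)) z ->
  nontrivial_critical_point f z <-> root P z.
Proof.
move=> P0 Dz; have multE := critical_multiplicity_mul_exp P0 Dz.
have df0 : ratfun_deriv f != 0.
  by rewrite derivE frac_neq0 ?mulf_neq0 ?expf_neq0 ?mulf_neq0.
have ordf : ratfun_ord f z = 0.
  move: Dz; rewrite !rootM !negb_or => /andP[/andP[az bz] /andP[pz qz]].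
  rewrite fE ratfun_ordE // !mupNroot ?subrr // rootE hornerM horner_exp.
    by rewrite mulf_neq0 ?expf_neq0.
  by rewrite mulf_neq0 ?expf_neq0.
apply: (iff_trans (nontrivial_critical_ord0 ordf df0)).
by rewrite multE ltz_nat mup_gt0.
Qed.

(** The power contributes no order at [z], and by coprimality the orders of [a] and [b] do not
    cancel; hence [z] is a zero or pole of [f] itself. *)
Lemma not_nontrivial_critical_mul_exp z : coprimep a b ->
    root (a * b) z -> ~~ root (p * q) z ->
  ~ nontrivial_critical_point f z.
Proof.
rewrite !rootM negb_or => co abz /andP[pz qz].
have f0 : f != 0 by rewrite fE frac_neq0.
have ordf : ratfun_ord f z = (mup z a)%:Z - (mup z b)%:Z.
  by rewrite fE ratfun_ordE // !mupMl // rootE horner_exp expf_neq0.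
apply: not_nontrivial_critical_ord => //; rewrite ordf subr_eq0 eqz_nat.
case/orP: abz => [az|bz].
  by rewrite (mupNroot (coprimep_root co az)) -lt0n mup_gt0.
rewrite coprimep_sym in co.
by rewrite (mupNroot (coprimep_root co bz)) eq_sym -lt0n mup_gt0.
Qed.

End PowerProduct.

End ReducedFractions.

(** * Vanishing order and non-vanishing of Wronskians in characteristic 0 *)

Section Wronskian.
Variable C : numFieldType.
Implicit Types (p q a b : {poly C}) (z : C).

(** Differentiating [('X - z%:P) ^+ k.+1 * a1] lowers the order by exactly one, since the factor
    [k.+1] is nonzero in characteristic 0. *)
Lemma wronskian_root a b z : a != 0 -> root a z -> ~~ root b z ->
  exists2 w, wronskian a b = ('X - z%:P) ^+ (mup z a).-1 * w & ~~ root w z.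
Proof.
move=> a0 az bz; have [a1 aE a1z] := mup_decomp z a0.
move: aE; rewrite -mup_gt0 // in az; case: (mup z a) az => // k _ aE /=.
exists (k.+1%:R *: (a1 * b) + ('X - z%:P) * wronskian a1 b).
  rewrite /wronskian aE derivM deriv_exp derivXsubC mul1r -mulr_natl /=.
  by rewrite -mul_polyC polyC_natr exprS; ring.
by rewrite rootE !hornerE subrr mul0r addr0 !mulf_neq0 // pnatr_eq0.
Qed.

(** Only one of [a] and [b] vanishes at [z]; antisymmetry reduces a root of [b] to a root of [a]. *)
Lemma wronskian_root_coprime a b z : a != 0 -> b != 0 -> coprimep a b ->
    root (a * b) z ->
  exists2 w, wronskian a b = ('X - z%:P) ^+ (mup z (a * b)).-1 * w
             & ~~ root w z.
Proof.
move=> a0 b0 co; rewrite rootM => /orP[az|bz].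
  have bz := coprimep_root co az; rewrite mupMl //.
  exact: wronskian_root.
rewrite coprimep_sym in co; have az := coprimep_root co bz.
rewrite mupMr //; have [w wE wz] := wronskian_root b0 bz az.
by exists (- w); rewrite ?rootN // wronskianC wE mulrN.
Qed.

Lemma deriv_eq0_const p : p^`() = 0 -> p = (p`_0)%:P.
Proof.
move=> dp0; apply/size1_polyC; rewrite leqNgt; apply/negP => sz.
have p0 : p != 0 by rewrite -size_poly_gt0 ltnW.
have : lead_coef p = 0.
  have [k kE] : exists k, size p = k.+2 by case: (size p) sz => [|[|k]] //; exists k.
  rewrite lead_coefE kE /=; have := congr1 (fun q : {poly C} => q`_k) dp0.
  by rewrite coef_deriv coef0 => /eqP; rewrite mulrn_eq0 => /eqP.
by move/eqP; rewrite lead_coef_eq0 (negPf p0).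
Qed.

(** If [p' q = p q'], coprimality makes [q] divide [q'], which is then 0 by degree. So [p'] is 0
    too, and the quotient is constant. *)
Lemma wronskian_neq0 p q : q != 0 -> coprimep p q ->
  ratfun_nonconstant (p%:F / q%:F) -> wronskian p q != 0.
Proof.
move=> q0 co nonc; apply/eqP => /eqP; rewrite subr_eq0 => /eqP e.
have dq0 : q^`() = 0.
  apply: contraTeq isT => dq0; have : q %| q^`().
    by rewrite -(Gauss_dvdpr _ (_ : coprimep q p)) 1?coprimep_sym // -e dvdp_mull.
  by move/(dvdp_leq dq0); rewrite leqNgt lt_size_deriv.
have dp0 : p^`() = 0.
  by move/eqP: e; rewrite dq0 mulr0 mulf_eq0 (negPf q0) orbF => /eqP.
rewrite (deriv_eq0_const dp0) (deriv_eq0_const dq0) in nonc q0.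
case: (nonc (p`_0 / q`_0)); rewrite polyC_eq0 in q0.
apply: (canLR (mulfK _)); first by rewrite tofrac_eq0 polyC_eq0.
by rewrite -tofracM -polyCM divfK.
Qed.

End Wronskian.

(** * From roots of a pencil of polynomials to critical points in a disc *)

Section ComplexPlane.
Variable R : realType.
Local Notation C := R[i].
Implicit Types (f g h : {fraction {poly C}}) (a b p q : {poly C}) (z w : C).

(** Bounds obtained as nonnegative complex numbers are brought back to [R] this way. *)
Lemma RReK (x : C) : 0 <= x -> ((complex.Re x)%:C)%C = x.
Proof. by move=> x0; rewrite RRe_real // ger0_real. Qed.

Lemma isolated_points z (s : seq C) :
  exists2 e : R, 0 < e & {in s, forall w, `|w - z| < (e%:C)%C -> w = z}.
Proof.
elim: s => [|x s [e e0 IH]]; first by exists 1.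
have [->|xz] := eqVneq x z.
  by exists e => // w /[!inE] /predU1P[-> //|]; apply: IH.
have nxz : 0 < `|x - z| by rewrite normr_gt0 subr_eq0.
exists (Num.min e (complex.Re `|x - z|)).
  by rewrite lt_min e0 -ltcR RReK // ltW.
move=> w /[!inE] /predU1P[->|ws] hw.
  suff : `|x - z| < `|x - z| by rewrite ltxx.
  apply: lt_le_trans hw _; rewrite -[leRHS]RReK // lecR.
  by rewrite ge_min lexx orbT.
by apply: IH => //; apply: lt_le_trans hw _; rewrite lecR ge_min lexx.
Qed.

(** For finitely many points, take the least radius and then, for each [e], the largest
    threshold. *)
Lemma uniform_eps_N (s : seq C) (Q : C -> R -> nat -> Prop) :
  {in s, forall z, exists2 e0 : R, 0 < e0 & forall e, 0 < e -> e < e0 ->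
    exists N : nat, forall n : nat, (N <= n)%N -> Q z e n} ->
  exists2 e0 : R, 0 < e0 & forall e, 0 < e -> e < e0 ->
    exists2 N : nat, (0 < N)%N &
      forall n : nat, (N <= n)%N -> {in s, forall z, Q z e n}.
Proof.
elim: s => [|x s IH] H; first by exists 1 => // e _ _; exists 1%N.
have [e1 e10 H1] := H x (mem_head _ _).
have [e2 e20 H2] := IH (fun z zs => H z (mem_behead (s := x :: s) zs)).
exists (Num.min e1 e2) => [|e e0]; first by rewrite lt_min e10.
rewrite lt_min => /andP[/(H1 e e0)[N1 {}H1] /(H2 e e0)[N2 N20 {}H2]].
exists (maxn N1 N2) => [|n]; first by rewrite leq_max N20 orbT.
rewrite geq_max => /andP[/H1 Qx /H2 Qs] z /[!inE] /predU1P[-> //|].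
exact: Qs.
Qed.

Lemma sum_count_undup (T : eqType) (s : seq T) :
  (\sum_(x <- undup s) count_mem x s)%N = size s.
Proof.
rewrite -sum1_size -[RHS]big_undup_iterop_count; apply: eq_bigr => x _.
by rewrite Monoid.iteropE iter_addn_0 mul1n.
Qed.

(** Turns a count of roots with repetition into a list of distinct critical points with
    multiplicities. The predicate [good] marks where the multiplicities of [f] and [P] agree. *)
Lemma exactly_critical_count f z e P c (rs : seq C) (good : pred C) :
    P != 0 -> P = c *: \prod_(r <- rs) ('X - r%:P) ->
    (forall w, `|w - z| < (e%:C)%C ->
       nontrivial_critical_point f w <-> good w && root P w) ->
    (forall w, good w -> critical_multiplicity f w = mup w P) ->
  exactly_critical_within f z e
    (count (fun w => (`|w - z| < (e%:C)%C) && good w) rs).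
Proof.
move=> P0 PE crit mult; set near := fun w => _.
have c0 : c != 0 by apply: contraNneq P0 => c0; rewrite PE c0 scale0r.
have rootP w : root P w = (w \in rs) by rewrite PE rootZ // root_prod_XsubC.
have mupP w : mup w P = count_mem w rs.
  by rewrite PE -mul_polyC mupMr ?rootC // mu_prod_XsubC.
exists (undup (filter near rs)); split; first exact: undup_uniq.
  move=> w; rewrite mem_undup mem_filter -rootP /near.
  split=> [/andP[/andP[wz gw] Pw]|[cw wz]].
    by split=> //; apply/crit => //; rewrite gw.
  by rewrite wz /=; apply/crit.
(* The length of the list of near roots is the sum, over its distinct members, of their numbers of
   occurrences. *)
rewrite -size_filter -sum_count_undup -[RHS]/(Posz _) (big_morph Posz PoszD (erefl _)).
apply: eq_big_seq => w; rewrite mem_undup mem_filter => /andP[nw _].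
have /andP[_ gw] := nw; rewrite mult // mupP.
congr (Posz _); rewrite count_filter; apply: eq_count => v /=.
by case: eqVneq => // ->; rewrite nw.
Qed.

Lemma isolated_root z r : r != 0 ->
  exists2 e : R, 0 < e &
    forall w, root r w -> `|w - z| < (e%:C)%C -> w = z.
Proof.
move=> r0; have [rs rE] := closed_field_poly_normal r.
have [e e0 He] := isolated_points z rs; exists e => // w.
by rewrite rE rootZ ?lead_coef_eq0 // root_prod_XsubC; apply: He.
Qed.

Section Near.
Variables (a b p q : {poly C}) (z : C).
Hypotheses (a0 : a != 0) (b0 : b != 0) (p0 : p != 0) (q0 : q != 0).
Hypotheses (co_ab : coprimep a b) (W0 : wronskian p q != 0).

Let A := wronskian a b * (p * q).
Let B := wronskian p q * (a * b).
Let D := a * b * (p * q).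

Let D0 : D != 0. Proof. by rewrite /D !mulf_neq0. Qed.
Let B0 : B != 0. Proof. by rewrite /B !mulf_neq0. Qed.

(** [A] vanishes at [z] to order exactly one less than [B], so adding any multiple of [B] leaves the
    order of [A] unchanged. *)
Lemma mup_pencil k : root (a * b) z -> ~~ root (p * q) z ->
    ~~ root (wronskian p q) z ->
  (mup z (A + k *: B)).+1 = mup z B.
Proof.
move=> abz pqz Wz.
have ab0 : a * b != 0 by rewrite mulf_neq0.
have [w wE wz] := wronskian_root_coprime a0 b0 co_ab abz.
have [c cE cz] := mup_decomp z ab0.
have mupB : mup z B = mup z (a * b) by rewrite /B mupMr.
have mup_gt : (0 < mup z (a * b))%N by rewrite mup_gt0.
rewrite mupB -[RHS](prednK mup_gt); congr _.+1.
apply: (@mup_exact _ _ _ _ (w * (p * q) +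
  k *: (wronskian p q * c) * ('X - z%:P))); last first.
  rewrite rootE hornerD [X in _ + X]hornerM hornerXsubC subrr mulr0 addr0 -rootE.
  by rewrite rootM negb_or wz.
rewrite /A /B wE {2}cE -{2}(prednK mup_gt) exprSr -!mul_polyC.
move: (('X - z%:P) ^+ _) (wronskian p q) => u v.
by ring.
Qed.

(** The pencil has [mup z B] roots in the disc. Those on [D] must be discarded, and a small radius
    ensures that they can only lie at [z] itself. *)
Lemma critical_points_near :
  exists2 e0 : R, 0 < e0 & forall e, 0 < e -> e < e0 ->
  exists N : nat, forall n : nat, (N <= n)%N ->
    (~~ root D z ->
      exactly_critical_within (a%:F / b%:F * (p%:F / q%:F) ^+ n) z e
        (mup z (wronskian p q))) /\
    (root (a * b) z -> ~~ root (p * q) z -> ~~ root (wronskian p q) z ->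
      exactly_critical_within (a%:F / b%:F * (p%:F / q%:F) ^+ n) z e 1).
Proof.
have [e1 e10 He1] := isolated_root z D0.
have [B1 BE B1z] := mup_decomp z B0.
have [e2 e20 He2] := count_roots_pencil A BE B1z.
exists (Num.min e1 (complex.Re e2)).
  by rewrite lt_min e10 -ltcR RReK // ltW.
move=> e e0; rewrite lt_min => /andP[ee1 ee2].
have [||K K0 HK] := He2 (e%:C)%C; first by rewrite ltcR.
  by rewrite -[ltRHS]RReK ?ltcR // ltW.
(* The Archimedean bound puts the exponent above [K]; the successor rules out exponent 0. *)
exists (Num.bound (complex.Re K)).+1 => -[//|n] le_n.
have [|P0 count_near] := HK n.+1.
  rewrite -[leLHS]RReK // -(rmorph_nat (real_complex R)) lecR.
  have ReK0 : 0 <= complex.Re K by rewrite -lecR RReK.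
  apply: ltW; apply: lt_trans (archi_boundP ReK0) _.
  by rewrite ltr_nat.
set P := A + _ in P0 count_near.
set f := _ * _ ^+ n.+1.
have [rs PE] := closed_field_poly_normal P.
have {}count_near := count_near _ _ PE.
have exact_count : (root D z -> ~ nontrivial_critical_point f z) ->
    exactly_critical_within f z e
      (count (fun w => (`|w - z| < (e%:C)%C) && ~~ root D w) rs).
  move=> critD; apply: (exactly_critical_count P0 PE) => w.
    move=> wz; have [Dw|Dw] /= := boolP (root D w).
      split=> // crit; case: critD.
        by rewrite -(He1 w Dw (lt_trans wz _)) // ltcR.
      by rewrite -(He1 w Dw (lt_trans wz _)) // ltcR.
    exact: nontrivial_critical_mul_exp.
  exact: critical_multiplicity_mul_exp.
split=> [Dz|abz pqz Wz].
  (* With [z] off [D], the disc contains no root of [D], so nothing is discarded. *)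
  have -> : mup z (wronskian p q) = mup z B.
    by rewrite /B mupMl //; move: Dz; rewrite rootM negb_or => /andP[].
  rewrite -count_near.
  have -> : count (fun w => `|w - z| < (e%:C)%C) rs =
      count (fun w => (`|w - z| < (e%:C)%C) && ~~ root D w) rs.
    apply: eq_count => w; case: (boolP (_ < _)) => //= wz.
    by apply/esym; apply: contra Dz => Dw; rewrite -(He1 w Dw (lt_trans wz _)) // ltcR.
  by apply: exact_count => /idP; rewrite (negPf Dz).
have Dz : root D z by rewrite rootM abz.
have mupP : mup z P = count_mem z rs.
  by rewrite PE -mul_polyC mupMr ?rootC ?lead_coef_eq0 // mu_prod_XsubC.
(* The copies of [z] among the roots number one less than all the roots in the disc, so a single
   root remains. *)
have := mup_pencil n.+1%:R abz pqz Wz; rewrite -/P mupP -count_near.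
have -> : count (fun w => `|w - z| < (e%:C)%C) rs = (count_mem z rs +
    count (fun w => (`|w - z| < (e%:C)%C) && ~~ root D w)%R rs)%N.
  rewrite -size_filter -(count_predC (pred1 z)) !count_filter; congr (_ + _)%N.
    apply: eq_count => w /=; case: eqVneq => //= ->.
    by rewrite subrr normr0 ltcR.
  apply: eq_count => w /=; rewrite andbC.
  case: (boolP (_ < _)) => //= wz; congr (~~ _); apply/eqP/idP => [-> //|Dw].
  by rewrite (He1 w Dw (lt_trans wz _)) // ltcR.
rewrite -addn1 => /addnI; rewrite -[1]/(Posz 1%N) => ->.
by apply: exact_count => _; exact: not_nontrivial_critical_mul_exp.
Qed.
End Near.

End ComplexPlane.

(** The exclusions in both clauses matter. If a zero or pole of [g] is also a non-trivial critical
    point of [h] of multiplicity m, the orders of [A] and [B] leave m + 1 nearby critical points; if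
    it is also a zero or pole of [h], they leave none. *)
Theorem theorem5 (R : realType) (g h : {fraction {poly R[i]}})
    (g_neq0 : g != 0) (h_nonconstant : ratfun_nonconstant h) :
  exists2 eps0 : R, 0 < eps0 &
    forall eps : R, 0 < eps -> eps < eps0 ->
    exists2 N : nat, (0 < N)%N &
      forall n : nat, (N <= n)%N ->
        (forall (z : R[i]) (m : int),
            nontrivial_critical_point h z ->
            critical_multiplicity h z = m ->
            ~~ ratfun_zero g z -> ~~ ratfun_pole g z ->
            exactly_critical_within (g * h ^+ n) z eps m)
        /\
        (forall z : R[i],
            ratfun_zero g z || ratfun_pole g z ->
            ~~ ratfun_zero h z -> ~~ ratfun_pole h z ->
            ~ critical_point h z ->
            exactly_critical_within (g * h ^+ n) z eps 1).
Proof.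
have [a [b [b0 co_ab gE]]] := ratfun_reduced g.
have [p [q [q0 co_pq hE]]] := ratfun_reduced h.
rewrite {g}gE {h}hE in g_neq0 h_nonconstant *.
have a0 : a != 0 by apply: contraNneq g_neq0 => ->; rewrite tofrac0 mul0r.
have p0 : p != 0.
  apply/eqP => p0; apply: (h_nonconstant 0).
  by rewrite p0 tofrac0 mul0r.
have W0 := wronskian_neq0 q0 co_pq h_nonconstant.
set W := wronskian p q in W0.
have B0 : W * (a * b) != 0 by rewrite !mulf_neq0.
(* Every point concerned is a root of this one polynomial, hence belongs to a finite list, over
   which the radius and the threshold can be made uniform. *)
have [rs BE] := closed_field_poly_normal (W * (a * b)).
have mem_rs z : root (W * (a * b)) z -> z \in rs.
  by rewrite BE rootZ ?lead_coef_eq0 // root_prod_XsubC.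
have [e0 e00 He0] := uniform_eps_N (fun z (_ : z \in rs) =>
  critical_points_near z a0 b0 p0 q0 co_ab W0).
exists e0 => // e e_gt0 e_lt; have [N N0 HN] := He0 e e_gt0 e_lt.
exists N => // n le_Nn; have {}HN := HN n le_Nn.
have dhE : ratfun_deriv (p%:F / q%:F) = W%:F / (q ^+ 2)%:F.
  exact: ratfun_derivE.
have multE z : ~~ root q z -> critical_multiplicity (p%:F / q%:F) z = mup z W.
  move=> qz; rewrite /critical_multiplicity dhE ratfun_ordE ?expf_neq0 //.
  by rewrite [mup z (q ^+ 2)]mupNroot ?subr0 // rootE horner_exp expf_neq0.
have critE z : ~~ root q z -> critical_point (p%:F / q%:F) z <-> root W z.
  move=> qz; rewrite -mup_gt0 // -ltz_nat -multE //.
  have dh0 : ratfun_deriv (p%:F / q%:F) != 0.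
    by rewrite dhE frac_neq0 ?expf_neq0.
  by split=> [[_ /andP[]] //|pos]; split=> //; apply/andP.
split=> [z m [crit hz hp] <- gz gp|z gzp hz hp ncrit].
  rewrite !ratfun_zero_reduced ?ratfun_pole_reduced // in hz hp gz gp.
  have {crit} Wz : root W z by apply/(critE z hp).
  rewrite multE //; apply: (HN z (mem_rs _ _)).1; first by rewrite rootM Wz.
  by rewrite !rootM !negb_or gz gp hz.
rewrite !ratfun_zero_reduced ?ratfun_pole_reduced // in hz hp gzp.
apply: (HN z (mem_rs _ _)).2; rewrite ?rootM ?negb_or ?gzp ?orbT ?hz //.
by apply/negP => Wz; apply: ncrit; apply/(critE z hp).
Qed.
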